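(* Let $k$ be an algebraically closed field of arbitrary characteristic, let $p$ be a prime, let $G$ be a finite $p$-group, and let $\omega: G\times G\times G\to k^\times$ be a (normalized) 3-cocycle. Let $V$ be a finite dimensional module over the twisted quantum double $D^{\omega}(G)$, and let $n$ be a positive integer. Then the image of the pure braid group $\mathcal{P}_n$ in $\operatorname{End}(V^{\otimes n})$, under the representation given by the braiding of the category of finite dimensional $D^\omega(G)$-modules, is also a (finite) $p$-group.
   Context: **Braid groups.** $\mathcal{B}_n$ is the group with generators $\beta_1,\dots,\beta_{n-1}$ and relations $\beta_i\beta_{i+1}\beta_i=\beta_{i+1}\beta_i\beta_{i+1}$ for $1\le i\le n-2$ and $\beta_i\beta_j=\beta_j\beta_i$ for $|i-j|\ge 2$. The pure braid group $\mathcal{P}_n$ is the kernel of the surjective homomorphism $\mathcal{B}_n\to S_n$, $\beta_i\mapsto(i,i+1)$. **3-cocycle.** $\omega$ satisfies $\omega(a,b,c)\,\omega(a,bc,d)\,\omega(b,c,d)=\omega(ab,c,d)\,\omega(a,b,cd)$ for all $a,b,c,d\in G$; normalized means $\omega(a,b,c)=1$ whenever one of $a,b,c$ is the identity $e$ of $G$. **Twisted quantum double.** $D^\omega(G)$ is the quasi-Hopf algebra with underlying vector space $(kG)^*\otimes kG$, with basis $\delta_x\overline{g}:=\delta_x\otimes g$ ($x,g\in G$), where $\delta_x\in (kG)^*$ is the function with $\delta_x(h)=\delta_{x,h}$. Multiplication: $$(\delta_x\overline{g})(\delta_y\overline{h})=\theta_x(g,h)\,\delta_{x,gyg^{-1}}\,\delta_x\overline{gh},\qquad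 \theta_x(g,h)=\frac{\omega(x,g,h)\,\omega(g,h,h^{-1}g^{-1}xgh)}{\omega(g,g^{-1}xg,h)}.$$ Write $\delta_x=\delta_x\overline{e}$ and $\overline{g}=\sum_{x\in G}\delta_x\overline{g}$; the unit is $\overline{e}$. Coproduct: $$\Delta(\delta_x\overline{g})=\sum_{yz=x}\gamma_g(y,z)\,\delta_y\overline{g}\otimes\delta_z\overline{g},\qquad \gamma_g(y,z)=\frac{\omega(y,z,g)\,\omega(g,g^{-1}yg,g^{-1}zg)}{\omega(y,g,g^{-1}zg)}.$$ The associator is $\Phi=\sum_{a,b,c\in G}\omega(a,b,c)^{-1}\delta_a\otimes\delta_b\otimes\delta_c$, and the universal $R$-matrix is $R=\sum_{g\in G}\delta_g\otimes\overline{g}$. **Braided category and braid group representations.** Finite dimensional (left) $D^\omega(G)$-modules form a braided tensor category: the tensor product over $k$ is a module via $\Delta$; the associativity isomorphism $(X\otimes Y)\otimes Z\to X\otimes(Y\otimes Z)$ is the action of $\Phi$; the braiding $c_{X,Y}:X\otimes Y\to Y\otimes X$ is $c_{X,Y}=\sigma\circ R$, i.e. the action of $R$ followed by the flip $\sigma$. For a module $V$, the representation of $\mathcal{B}_n$ on $V^{\otimes n}$ sends $\beta_i$ to $\check R_i=\mathrm{Id}_V^{\otimes(i-1)}\otimes c_{V,V}\otimes\mathrm{Id}_V^{\otimes(n-i-1)}$; the representation of $\mathcal{P}_n$ is its restriction. Here $V^{\otimes n}$ is taken with a fixed bracketing, and $\check R_i$ is understood up to inserting associativity isomorphisms: pass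 to a bracketing in which the factors $i,i+1$ are bracketed together, apply $c_{V,V}$ to them, and pass back. (Different choices of the fixed bracketing give isomorphic representations.) *)

(* Defs.v *)
From HB Require Import structures.
From mathcomp Require Import all_boot all_order all_algebra all_fingroup all_solvable.
From mathcomp Require Import boolp zify ring.

Set Implicit Arguments.
Unset Strict Implicit.
Unset Printing Implicit Defensive.

Import GRing.Theory.
Local Open Scope ring_scope.
Local Open Scope quotient_scope.

Section BraidGroup.
Variable n : nat.

(* The letter (i, false) is the generator $\beta_{i+1}$ (indices are 0-based
   here) and (i, true) is its inverse. *)
Definition braid_letter : Type := ('I_n.-1 * bool)%type.
Definition braid_word : Type := seq braid_letter.

HB.instance Definition _ := Choice.on braid_letter.
HB.instance Definition _ := Choice.on braid_word.

Definition gen_letter (i : 'I_n.-1) : braid_letter := (i, false).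
Definition inv_letter (l : braid_letter) : braid_letter := (l.1, ~~ l.2).

Inductive braid_eq : braid_word -> braid_word -> Prop :=
| braid_eq_refl u : braid_eq u u
| braid_eq_sym u v : braid_eq u v -> braid_eq v u
| braid_eq_trans v u w : braid_eq u v -> braid_eq v w -> braid_eq u w
| braid_eq_cat u u' v v' :
    braid_eq u u' -> braid_eq v v' -> braid_eq (u ++ v) (u' ++ v')
| braid_eq_cancel l : braid_eq [:: l; inv_letter l] [::]
| braid_eq_braid (i j : 'I_n.-1) : i.+1 = j ->
    braid_eq (map gen_letter [:: i; j; i]) (map gen_letter [:: j; i; j])
| braid_eq_comm (i j : 'I_n.-1) : (i.+1 < j)%N ->
    braid_eq (map gen_letter [:: i; j]) (map gen_letter [:: j; i]).

Definition braid_eqb : rel braid_word := fun u v => `[< braid_eq u v >].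

Lemma braid_eqb_refl : reflexive braid_eqb.
Proof. by move=> u; apply/asboolP; exact: braid_eq_refl. Qed.

Lemma braid_eqb_sym : symmetric braid_eqb.
Proof. by move=> u v; apply/asboolP/asboolP => /braid_eq_sym. Qed.

Lemma braid_eqb_trans : transitive braid_eqb.
Proof.
move=> v u w /asboolP uv /asboolP vw; apply/asboolP.
exact: braid_eq_trans uv vw.
Qed.

Canonical braid_equiv := EquivRel braid_eqb
  braid_eqb_refl braid_eqb_sym braid_eqb_trans.

Definition braid : Type := {eq_quot braid_equiv}.

HB.instance Definition _ := Choice.on braid.

Definition to_braid (w : braid_word) : braid := (\pi_({eq_quot braid_equiv}) w)%qT.
Definition braid_repr (b : braid) : braid_word :=
  generic_quotient.repr (b : {eq_quot braid_equiv}).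

Lemma braid_reprK : cancel braid_repr to_braid.
Proof. by move=> b; rewrite /to_braid /braid_repr reprK. Qed.

Lemma to_braidP u v : to_braid u = to_braid v <-> braid_eq u v.
Proof. by split=> [/eqmodP/asboolP|uv] //; apply/eqmodP/asboolP. Qed.

Definition inv_word (w : braid_word) : braid_word := rev (map inv_letter w).

Lemma inv_letterK : involutive inv_letter.
Proof. by case=> i b; rewrite /inv_letter /= negbK. Qed.

Lemma inv_wordK : involutive inv_word.
Proof.
by move=> w; rewrite /inv_word map_rev revK -map_comp (eq_map inv_letterK) map_id.
Qed.

Lemma cat_inv_word w : braid_eq (w ++ inv_word w) [::].
Proof.
elim: w => [|l w IH]; first exact: braid_eq_refl.
rewrite /inv_word map_cons rev_cons -cats1 -/(inv_word w).
apply: (@braid_eq_trans [:: l; inv_letter l]); last exact: braid_eq_cancel.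
rewrite -[l :: w]cat1s -catA.
apply: (braid_eq_cat (braid_eq_refl [:: l])).
rewrite catA -[X in braid_eq _ X]cat0s.
exact: braid_eq_cat IH (braid_eq_refl _).
Qed.

Lemma inv_word_cat w : braid_eq (inv_word w ++ w) [::].
Proof. by rewrite -{2}[w]inv_wordK; exact: cat_inv_word. Qed.

Lemma braid_eq_inv_word u v : braid_eq u v -> braid_eq (inv_word u) (inv_word v).
Proof.
move=> uv; apply: (@braid_eq_trans (inv_word u ++ (v ++ inv_word v))).
  rewrite -[X in braid_eq X _]cats0.
  by apply: braid_eq_cat (braid_eq_refl _) (braid_eq_sym (cat_inv_word v)).
rewrite catA -[X in braid_eq _ X]cat0s.
apply: braid_eq_cat (braid_eq_refl _).
apply: (@braid_eq_trans (inv_word u ++ u)); last exact: inv_word_cat.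
exact: braid_eq_cat (braid_eq_refl _) (braid_eq_sym uv).
Qed.

Definition braid_one : braid := to_braid [::].
Definition braid_mul (a b : braid) : braid :=
  to_braid (braid_repr a ++ braid_repr b).
Definition braid_inv (a : braid) : braid := to_braid (inv_word (braid_repr a)).

Lemma braid_repr_to w : braid_eq (braid_repr (to_braid w)) w.
Proof. by apply/to_braidP; rewrite braid_reprK. Qed.

Lemma braid_mulE u v : braid_mul (to_braid u) (to_braid v) = to_braid (u ++ v).
Proof. by apply/to_braidP/braid_eq_cat; exact: braid_repr_to. Qed.

Lemma braid_invE u : braid_inv (to_braid u) = to_braid (inv_word u).
Proof. by apply/to_braidP/braid_eq_inv_word; exact: braid_repr_to. Qed.

Lemma braid_mulA : associative braid_mul.
Proof.
move=> a b c; rewrite -[a]braid_reprK -[b]braid_reprK -[c]braid_reprK.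
by rewrite !braid_mulE catA.
Qed.

Lemma braid_mul1 : left_id braid_one braid_mul.
Proof. by move=> a; rewrite -[a]braid_reprK braid_mulE. Qed.

Lemma braid_mulr1 : right_id braid_one braid_mul.
Proof. by move=> a; rewrite -[a]braid_reprK braid_mulE cats0. Qed.

Lemma braid_mulV : left_inverse braid_one braid_inv braid_mul.
Proof.
move=> a; rewrite -[a]braid_reprK braid_invE braid_mulE.
exact/to_braidP/inv_word_cat.
Qed.

Lemma braid_mulrV : right_inverse braid_one braid_inv braid_mul.
Proof.
move=> a; rewrite -[a]braid_reprK braid_invE braid_mulE.
exact/to_braidP/cat_inv_word.
Qed.

HB.instance Definition _ := isGroup.Build braid
  braid_mulA braid_mul1 braid_mulr1 braid_mulV braid_mulrV.

Definition beta (i : 'I_n.-1) : braid := to_braid [:: gen_letter i].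

Lemma strand_proof (i : 'I_n.-1) : (i.+1 < n)%N.
Proof. by move: (ltn_ord i); rewrite ltn_predRL. Qed.

Definition strand (i : 'I_n.-1) : 'I_n := Ordinal (ltnW (strand_proof i)).
Definition next_strand (i : 'I_n.-1) : 'I_n := Ordinal (strand_proof i).

Definition swap (i : 'I_n.-1) : 'S_n := tperm (strand i) (next_strand i).

(* A transposition is its own inverse, so the sign of a letter is irrelevant. *)
Definition word_perm (w : braid_word) : 'S_n := (\prod_(l <- w) swap l.1)%g.

Lemma word_perm_cat u v : word_perm (u ++ v) = (word_perm u * word_perm v)%g.
Proof. by rewrite /word_perm big_cat. Qed.

Lemma tperm_braid (T : finType) (x y z : T) : x != y -> y != z -> x != z ->
  (tperm x y * (tperm y z * tperm x y) = tperm y z * (tperm x y * tperm y z))%g.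
Proof.
move=> xy yz xz.
have tpJ (s t : {perm T}) (u v : T) : s = tperm u v -> (s * (t * s) = t ^ s)%g.
  by move=> ->; rewrite /conjg tpermV.
rewrite (tpJ _ _ _ _ erefl) (tpJ _ _ _ _ erefl) !tpermJ.
by rewrite tpermR tpermL !tpermD // eq_sym.
Qed.

Lemma word_perm_eq u v : braid_eq u v -> word_perm u = word_perm v.
Proof.
elim=> {u v} [//|//|u v w _ -> _ -> //|u u' v v' _ IHu _ IHv|l|i j ij|i j ij].
- by rewrite !word_perm_cat IHu IHv.
- by rewrite /word_perm !big_cons big_nil mulg1 tperm2.
- rewrite /word_perm !big_cons !big_nil /= !mulg1 /swap.
  have -> : strand j = next_strand i by apply: val_inj.
  by apply: tperm_braid; rewrite -val_eqE /= -?ij; lia.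
- rewrite /word_perm !big_cons !big_nil /= !mulg1 /swap.
  rewrite conjgC tpermJ !tpermD //; rewrite -val_eqE /=; lia.
Qed.

Definition braid_perm (b : braid) : 'S_n := word_perm (braid_repr b).

Lemma braid_permE w : braid_perm (to_braid w) = word_perm w.
Proof. exact/word_perm_eq/braid_repr_to. Qed.

Lemma braid_perm_beta i : braid_perm (beta i) = swap i.
Proof. by rewrite braid_permE /word_perm big_cons big_nil mulg1. Qed.

Lemma braid_perm_morphism : monoid.monoid_morphism braid_perm.
Proof.
split=> [|a b]; first by rewrite braid_permE /word_perm big_nil.
rewrite -[a]braid_reprK -[b]braid_reprK [X in braid_perm X]braid_mulE !braid_permE.
exact: word_perm_cat.
Qed.

HB.instance Definition _ :=
  monoid.isUMagmaMorphism.Build braid 'S_n braid_perm braid_perm_morphism.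

Definition pure_braid (b : braid) : Prop := braid_perm b = 1%g.

End BraidGroup.

Section Tensor.
Variable k : fieldType.
Implicit Types U V W : vectType k.

(* The coordinates of the elements of V $\otimes$ W on the basis e_i $\otimes$ f_j, where
   (e_i) and (f_j) are the bases of V and W chosen by vbasis. *)
Definition tensor V W : vectType k := 'M[k]_(\dim {:V}, \dim {:W}).

Definition tens V W (v : V) (w : W) : tensor V W :=
  \matrix_(i, j) (coord (vbasis {:V}) i v * coord (vbasis {:W}) j w).

Definition bilin U V W (b : V -> W -> U) : Prop :=
  (forall v, linear (b v)) /\ (forall w, linear (b^~ w)).

(* For a bilinear b, the unique linear map with v $\otimes$ w |-> b v w. *)
Definition tens_lift U V W (b : V -> W -> U) : 'Hom(tensor V W, U) :=
  linfun (fun t : 'M[k]_(\dim {:V}, \dim {:W}) =>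
    \sum_i \sum_j t i j *: b (vbasis {:V})`_i (vbasis {:W})`_j).

Lemma bilin_tens V W : bilin (@tens V W).
Proof.
by split=> x a y z; apply/matrixP=> i j; rewrite !mxE linearD linearZ /=; ring.
Qed.

Lemma tens_lift_tens U V W (b : V -> W -> U) v w :
  bilin b -> tens_lift b (tens v w) = b v w.
Proof.
move=> [br bl].
pose L := fun t : 'M[k]_(\dim {:V}, \dim {:W}) =>
  \sum_i \sum_j t i j *: b (vbasis {:V})`_i (vbasis {:W})`_j.
have LP : linear L.
  move=> a s t; rewrite /L scaler_sumr -big_split; apply: eq_bigr => i _ /=.
  rewrite scaler_sumr -big_split; apply: eq_bigr => j _ /=.
  by rewrite !mxE scalerDl scalerA.
pose Lm := GRing.isLinear.Build k _ _ _ L LP.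
pose LL : {linear tensor V W -> U} := HB.pack L Lm.
rewrite /tens_lift -/L -[L]/(LL : _ -> _) lfunE /= /L.
have sumr x (I : finType) (s : I -> k) (y : I -> W) :
    b x (\sum_i s i *: y i) = \sum_i s i *: b x (y i).
  pose F : {linear W -> U} := HB.pack (b x) (GRing.isLinear.Build k _ _ _ _ (br x)).
  rewrite -[b x]/(F : _ -> _) linear_sum; apply: eq_bigr => i _.
  by rewrite linearZ.
have suml y (I : finType) (s : I -> k) (x : I -> V) :
    b (\sum_i s i *: x i) y = \sum_i s i *: b (x i) y.
  pose F : {linear V -> U} := HB.pack (b^~ y) (GRing.isLinear.Build k _ _ _ _ (bl y)).
  rewrite -[b _ y]/(F _) linear_sum; apply: eq_bigr => i _.
  by rewrite linearZ.
rewrite {2}(coord_vbasis (memvf v)) {2}(coord_vbasis (memvf w)) suml.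
apply: eq_bigr => i _; rewrite sumr scaler_sumr; apply: eq_bigr => j _.
by rewrite mxE scalerA.
Qed.

Lemma tens_sum V W (t : tensor V W) :
  t = \sum_i \sum_j (t : 'M[k]_(\dim {:V}, \dim {:W})) i j *:
        tens (vbasis {:V})`_i (vbasis {:W})`_j.
Proof.
apply/matrixP => i j; rewrite summxE (bigD1 i) //= summxE (bigD1 j) //= !mxE.
have fV := basis_free (vbasisP {:V}); have fW := basis_free (vbasisP {:W}).
rewrite !coord_free // !eqxx !mulr1 !big1 ?addr0 // => [i' /negPf ni|j' /negPf nj].
  rewrite summxE big1 // => j' _; rewrite !mxE !coord_free //.
  by rewrite ni mul0r mulr0.
by rewrite !mxE !coord_free // eqxx nj !mulr0.
Qed.

Lemma tens_ext U V W (f g : 'Hom(tensor V W, U)) :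
  (forall v w, f (tens v w) = g (tens v w)) -> f = g.
Proof.
move=> fg; apply/lfunP => t; rewrite [t]tens_sum !linear_sum.
apply: eq_bigr => i _; rewrite !linear_sum; apply: eq_bigr => j _.
by rewrite !linearZ /= fg.
Qed.

Definition tens_hom V W V' W' (f : 'Hom(V, V')) (g : 'Hom(W, W')) :
    'Hom(tensor V W, tensor V' W') :=
  tens_lift (fun v w => tens (f v) (g w)).

Definition tens_flip V W : 'Hom(tensor V W, tensor W V) :=
  tens_lift (fun v w => tens w v).

(* (u $\otimes$ v) $\otimes$ w |-> u $\otimes$ (v $\otimes$ w) *)
Definition tens_assoc U V W :
    'Hom(tensor (tensor U V) W, tensor U (tensor V W)) :=
  tens_lift (fun t w => tens_lift (fun u v => tens u (tens v w)) t).

Lemma tensDl V W (w : W) : linear ((@tens V W)^~ w).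
Proof. by case: (bilin_tens V W). Qed.

Lemma tensDr V W (v : V) : linear (@tens V W v).
Proof. by case: (bilin_tens V W). Qed.

Lemma tens_homE V W V' W' (f : 'Hom(V, V')) (g : 'Hom(W, W')) v w :
  tens_hom f g (tens v w) = tens (f v) (g w).
Proof.
rewrite tens_lift_tens //; split=> x a y z.
  by rewrite linearP tensDr.
by rewrite linearP tensDl.
Qed.

Lemma tens_flipE V W (v : V) (w : W) : tens_flip V W (tens v w) = tens w v.
Proof.
by rewrite tens_lift_tens //; split=> x a y z; rewrite (tensDl, tensDr).
Qed.

Lemma tens_assocE U V W (u : U) (v : V) (w : W) :
  tens_assoc U V W (tens (tens u v) w) = tens u (tens v w).
Proof.
have B z : bilin (fun x y => tens x (tens y z) : tensor U (tensor V W)).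
  by split=> x a y y'; rewrite ?tensDl ?tensDr.
rewrite tens_lift_tens ?tens_lift_tens //; split=> [t a z z'|z a t t'].
  rewrite -scale_lfunE -add_lfunE; congr (fun_of_lfun _ t).
  apply: tens_ext => x y.
  by rewrite add_lfunE scale_lfunE !tens_lift_tens // !tensDr.
by rewrite linearP.
Qed.

End Tensor.

Section QuantumDouble.
Variables (k : fieldType) (gT : finGroupType) (omega : gT -> gT -> gT -> k).
Implicit Types x y z g h a b c : gT.

Definition normalized_cocycle : Prop :=
  [/\ forall a b c, omega a b c != 0,
      forall a b c d,
        omega a b c * omega a (b * c)%g d * omega b c d =
        omega (a * b)%g c d * omega a b (c * d)%g
    & forall a b, [/\ omega 1%g a b = 1, omega a 1%g b = 1 & omega a b 1%g = 1]].

(* x ^ g denotes g^-1 x g. *)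
Definition theta x g h : k :=
  omega x g h * omega g h (x ^ (g * h))%g / omega g (x ^ g)%g h.

Definition gamma g y z : k :=
  omega y z g * omega g (y ^ g)%g (z ^ g)%g / omega y g (z ^ g)%g.

Definition double : vectType k := {ffun gT * gT -> k^o}.

(* The basis vector $\delta_x \overline{g}$. *)
Definition dbas x g : double := [ffun u => ((u == (x, g))%:R : k^o)].

Definition ddelta x : double := dbas x 1%g.
Definition dbar g : double := \sum_x dbas x g.
Definition dunit : double := dbar 1%g.

(* The linear map with $\delta_x \overline{g}$ |-> f x g. *)
Definition double_lift (U : vectType k) (f : gT -> gT -> U) : 'Hom(double, U) :=
  linfun (fun t : {ffun gT * gT -> k^o} => \sum_x \sum_g (t (x, g) : k) *: f x g).

Lemma double_liftE (U : vectType k) (f : gT -> gT -> U) x g :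
  double_lift f (dbas x g) = f x g.
Proof.
pose L := fun t : {ffun gT * gT -> k^o} => \sum_x \sum_g (t (x, g) : k) *: f x g.
have LP : linear L.
  move=> a s t; rewrite /L scaler_sumr -big_split; apply: eq_bigr => i _ /=.
  rewrite scaler_sumr -big_split; apply: eq_bigr => j _ /=.
  by rewrite !ffunE scalerDl scalerA.
pose LL : {linear double -> U} := HB.pack L (GRing.isLinear.Build k _ _ _ L LP).
rewrite /double_lift -/L -[L]/(LL : _ -> _) lfunE /= /L.
rewrite (bigD1 x) //= (bigD1 g) //= ffunE eqxx scale1r !big1 ?addr0 // => [y|h] ne.
  by rewrite big1 // => h _; rewrite ffunE xpair_eqE (negPf ne) scale0r.
by rewrite ffunE xpair_eqE (negPf ne) andbF scale0r.
Qed.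

Definition dmul : double -> double -> double := fun s t =>
  double_lift (fun x g => double_lift (fun y h =>
    if y == (x ^ g)%g then theta x g h *: dbas x (g * h)%g else 0) t) s.

Lemma dmul_dbas x g y h :
  dmul (dbas x g) (dbas y h) =
  (theta x g h * (x == g * y * g^-1)%g%:R) *: dbas x (g * h)%g.
Proof.
have -> : (x == g * y * g^-1)%g = (y == x ^ g)%g.
  rewrite [RHS]eq_sym (can2_eq (conjgK g) (conjgKV g)).
  by rewrite conjgE invgK mulgA.
by rewrite /dmul !double_liftE; case: eqP; rewrite ?mulr1 // mulr0 scale0r.
Qed.

Definition dcoprod : 'Hom(double, tensor double double) :=
  double_lift (fun x g => \sum_(u : gT * gT | (u.1 * u.2)%g == x)
    gamma g u.1 u.2 *: tens (dbas u.1 g) (dbas u.2 g)).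

Definition Phi : tensor (tensor double double) double :=
  \sum_a \sum_b \sum_c
    (omega a b c)^-1 *: tens (tens (ddelta a) (ddelta b)) (ddelta c).

Definition Rmatrix : tensor double double :=
  \sum_g tens (ddelta g) (dbar g).

(* A finite dimensional space with linear operators indexed by the double;
   the module axioms are is_module. *)
Record dspace := DSpace {
  dcarrier :> vectType k;
  dact : 'Hom(double, 'End(dcarrier))
}.

Definition is_module (X : dspace) : Prop :=
  dact X dunit = \1%VF /\
  forall s t : double, dact X (dmul s t) = (dact X s \o dact X t)%VF.

Definition dact2 (X Y : dspace) :
    'Hom(tensor double double, 'End(tensor X Y)) :=
  tens_lift (fun s t : double => tens_hom (dact X s) (dact Y t)).

Definition dact3 (X Y Z : dspace) :
    'Hom(tensor (tensor double double) double, 'End(tensor (tensor X Y) Z)) :=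
  tens_lift (fun s (t : double) => tens_hom (dact2 X Y s) (dact Z t)).

Definition dtensor (X Y : dspace) : dspace :=
  @DSpace (tensor X Y) (dact2 X Y \o dcoprod)%VF.

Definition associator (X Y Z : dspace) :
    'Hom(tensor (tensor X Y) Z, tensor X (tensor Y Z)) :=
  (tens_assoc X Y Z \o dact3 X Y Z Phi)%VF.

Definition braiding (X Y : dspace) : 'Hom(tensor X Y, tensor Y X) :=
  (tens_flip X Y \o dact2 X Y Rmatrix)%VF.

Variable V : dspace.

(* The tensor power with m.+1 factors, bracketed to the left:
   (... ((V $\otimes$ V) $\otimes$ V) ...) $\otimes$ V. *)
Fixpoint tpower m : dspace := if m is m'.+1 then dtensor (tpower m') V else V.

(* The braiding of the last two of the m.+2 factors; for m = m'.+1 these are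
   first bracketed together by the associativity isomorphism
   (X $\otimes$ V) $\otimes$ V -> X $\otimes$ (V $\otimes$ V), where X has m'.+1 factors;
   the inverse in lfun_scope is the true inverse, as al is bijective. *)
Definition braid_last m : 'End(tpower m.+1) :=
  match m return 'End(tpower m.+1) with
  | 0 => braiding V V
  | m'.+1 => let al := associator (tpower m') V V in
      (al^-1 \o tens_hom \1 (braiding V V) \o al)%VF
  end.

(* The braiding of the factors i and i.+1 (counted from 0, i < m). *)
Fixpoint braid_op m (i : nat) : 'End(tpower m) :=
  match m return 'End(tpower m) with
  | 0 => \1%VF
  | m'.+1 => if (i < m')%N then tens_hom (braid_op m' i) \1%VF
             else braid_last m'
  end.

Variable n : nat.

Definition letter_op (l : braid_letter n) : 'End(tpower n.-1) :=
  if l.2 then ((braid_op n.-1 l.1)^-1)%VF else braid_op n.-1 l.1.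

Definition word_op (w : braid_word n) : 'End(tpower n.-1) :=
  foldr (fun l f => (letter_op l \o f)%VF) \1%VF w.

(* The elements of the image of the pure braid group: the operators of the words
   in the generators and their inverses that represent a pure braid. *)
Definition pure_braid_image (f : 'End(tpower n.-1)) : Prop :=
  exists2 w : braid_word n, pure_braid (to_braid w) & f = word_op w.

End QuantumDouble.

(* S, with the composition of endomorphisms, is a finite p-group. *)
Definition finite_pgroup_of_endos (k : fieldType) (W : vectType k) (p : nat)
    (S : 'End(W) -> Prop) : Prop :=
  exists (H : finGroupType) (phi : H -> 'End(W)),
    [/\ (p.-group [set: H])%g, injective phi, phi 1%g = \1%VF,
        forall x y : H, phi (x * y)%g = (phi x \o phi y)%VF
      & forall f, S f <-> exists x, f = phi x].

(* Main.v *)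
(** The subspaces [V_x = delta_x V] grade [V] by [G], and every braid generator
    sends [V_{g_1} (x) ... (x) V_{g_n}] to the piece obtained by the Hurwitz
    move, acting as a scalar times elements [bar a] on the factors.

    Scalars.  With [q = #|G|] and [mu(a,b) = prod_d omega(a,b,d)], multiplying
    the cocycle identity over its last variable gives [omega^q = d mu].  Hence,
    after rescaling the action of [bar a] and the pure tensors of each degree by
    [q]-th roots of values of [mu], all the scalars become [q]-th roots of 1.
    So only finitely many operators occur.

    Degrees.  A pure braid acts on [G^n] by conjugating each coordinate by a
    word in the coordinates.  It is therefore trivial modulo the top of the upper
    central series, and if some power of it is trivial modulo one term, then the
    [q]-th power of that is trivial modulo the next one.  So some [p]-power of it
    fixes all degrees; such an operator acts on each piece as a [q]-th root of 1
    times a tensor product of rescaled [bar h_i], whose [q]-th power is a [q]-th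
    root of 1. *)
From HB Require Import structures.
Require Import Defs.
From mathcomp Require Import all_boot all_order all_algebra all_fingroup all_solvable.
From mathcomp Require Import boolp ring.

Set Implicit Arguments.
Unset Strict Implicit.
Unset Printing Implicit Defensive.

Import GRing.Theory.

(** * Conjugation by words in nilpotent groups *)

Section TwistedConjugation.
Local Open Scope group_scope.
Variables (gT : finGroupType) (I : finType).
Implicit Types (g : {ffun I -> gT}) (s : {perm I}) (h : {ffun I -> gT} -> I -> gT).

(* What a braid does to degrees: [s] is its permutation and [h g i] is the
   element acting on the factor that arrives at position [i]. *)
Definition twist s h g : {ffun I -> gT} := [ffun i => g (s i) ^ (h g i)^-1].

Definition congruent (K : {group gT}) g g' :=
  forall i, coset K (g i) = coset K (g' i).

(* Holds when each [h _ i] is a word in the coordinates. *)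
Definition respects h := forall K : {group gT}, K <| [set: gT] ->
  forall g g', congruent K g g' -> forall i, coset K (h g i) = coset K (h g' i).

(** The factor arriving at [i] sits at [s2 i] after the first move, where [h1] has already acted on
    it; [h2] then acts on the left. *)
Definition twist_comp s1 h1 s2 h2 g i : gT := h2 (twist s1 h1 g) i * h1 g (s2 i).

Lemma twist_compE s1 h1 s2 h2 g :
  twist (s2 * s1) (twist_comp s1 h1 s2 h2) g = twist s2 h2 (twist s1 h1 g).
Proof. by apply/ffunP => i; rewrite !ffunE permM -conjgM -invMg. Qed.

Lemma twist1 g : twist 1 (fun _ _ => 1) g = g.
Proof. by apply/ffunP => i; rewrite ffunE perm1 invg1 conjg1. Qed.

Lemma respects1 : respects (fun _ _ => 1).
Proof. by []. Qed.

Lemma cosetMg (K : {group gT}) a b : K <| [set: gT] ->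
  coset K (a * b) = coset K a * coset K b.
Proof.
by move=> /andP[_ nK]; rewrite morphM //; apply: (subsetP nK); rewrite inE.
Qed.

Lemma cosetVg (K : {group gT}) a : K <| [set: gT] ->
  coset K a^-1 = (coset K a)^-1.
Proof.
by move=> /andP[_ nK]; rewrite morphV //; apply: (subsetP nK); rewrite inE.
Qed.

Lemma cosetJg (K : {group gT}) a b : K <| [set: gT] ->
  coset K (a ^ b) = coset K a ^ coset K b.
Proof. by move=> nK; rewrite !conjgE !(cosetMg, cosetVg). Qed.

Lemma coset_eqE (K : {group gT}) a b : K <| [set: gT] ->
  coset K a = coset K b <-> a^-1 * b \in K.
Proof.
move=> nK; have -> : (a^-1 * b \in K) = (coset K (a^-1 * b) == 1).
  have nb : a^-1 * b \in 'N(K) by case/andP: nK => _ /subsetP; apply; rewrite inE.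
  by apply/idP/eqP => [/coset_id | /(coset_idr nb)].
rewrite cosetMg // cosetVg // -eq_mulVg1.
by split=> [->|/eqP].
Qed.

Lemma twist_congruent s h (K : {group gT}) g g' : K <| [set: gT] -> respects h ->
  congruent K g g' -> congruent K (twist s h g) (twist s h g').
Proof.
move=> nK rh gg' i; rewrite !ffunE !cosetJg // !cosetVg //.
by rewrite gg' (rh _ nK _ _ gg').
Qed.

Lemma respects_comp s1 h1 s2 h2 :
  respects h1 -> respects h2 -> respects (twist_comp s1 h1 s2 h2).
Proof.
move=> r1 r2 K nK g g' gg' i; rewrite !cosetMg // (r1 _ nK _ _ gg').
by rewrite (r2 _ nK _ _ (twist_congruent s1 nK r1 gg')).
Qed.

Fixpoint twist_pow s h n : {ffun I -> gT} -> I -> gT :=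
  if n is n'.+1 then twist_comp (s ^+ n') (twist_pow s h n') s h
  else fun _ _ => 1.

Lemma respects_pow s h n : respects h -> respects (twist_pow s h n).
Proof.
move=> rh; elim: n => [|n IH]; first exact: respects1.
exact: respects_comp.
Qed.

Lemma twist_powE s h n g : twist (s ^+ n) (twist_pow s h n) g = iter n (twist s h) g.
Proof.
elim: n => [|n IH]; first exact: twist1.
by rewrite expgS twist_compE IH.
Qed.

(** No iterate changes [g], so every step contributes the same factor [h g i]. *)
Lemma twist_pow_fix h n g i : (forall g, twist 1 h g = g) ->
  twist_pow 1 h n g i = h g i ^+ n.
Proof.
move=> Th; elim: n => //= n IH.
by rewrite /twist_comp twist_powE iter_fix // perm1 IH -expgS.
Qed.

(** * One step down a central series *)

Section CentralStep.
Variables K L : {group gT}.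
Hypotheses (nK : K <| [set: gT]) (nL : L <| [set: gT]).
Hypothesis cKL : [~: L, [set: gT]] \subset K.

Lemma coset_central l x : l \in L -> commute (coset K l) (coset K x).
Proof.
move=> Ll; apply/commgP; rewrite /commg -cosetJg // -cosetVg // -cosetMg //.
by rewrite coset_id // (subsetP cKL) // mem_commg // inE.
Qed.

(** The two tuples agree modulo [L], so by [respects] their conjugators differ by an element of [L].
    Such an element is central modulo [K], hence conjugates trivially there; for the same reason
    each [w i] is unchanged by conjugation. *)
Lemma twist_central h g w : respects h -> (forall i, w i \in L) ->
  congruent K (twist 1 h [ffun i => g i * w i]) [ffun i => twist 1 h g i * w i].
Proof.
move=> rh Lw i; rewrite !ffunE !perm1.
set g' := [ffun i => _].
have gg' : congruent L g' g.
  by move=> j; rewrite ffunE cosetMg // (coset_id (Lw j)) mulg1.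
set a := h g' i; set b := h g i.
have ba : b^-1 * a \in L by apply/coset_eqE => //; exact/esym/(rh _ nL _ _ gg').
have fix_l l x : l \in L -> coset K l ^ coset K x = coset K l.
  by move=> Ll; rewrite conjgE (coset_central x Ll) mulKg.
have fix_g l x : l \in L -> coset K x ^ coset K l = coset K x.
  by move=> Ll; rewrite conjgE -(coset_central x Ll) mulKg.
have -> : a^-1 = (b^-1 * a)^-1 * b^-1 by rewrite invMg invgK mulgK.
rewrite conjgM [LHS]cosetJg // [X in X ^ _]cosetJg //.
rewrite (fix_g (b^-1 * a)^-1) ?groupV // [in LHS]cosetMg // conjMg (fix_l (w i)) //.
by rewrite [RHS]cosetMg // cosetJg.
Qed.

(** The displacement [z i] lies in [L], so by [twist_central] each further application carries the
    accumulated power along and contributes one more [z i]. *)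
Lemma iter_twist_central h n g : respects h ->
  (forall g, congruent L (twist 1 h g) g) ->
  congruent K (iter n (twist 1 h) g)
    [ffun i => g i * ((g i)^-1 * twist 1 h g i) ^+ n].
Proof.
move=> rh Th; set z := fun i => (g i)^-1 * twist 1 h g i.
have Lz i : z i \in L by apply/coset_eqE => //; apply/esym/Th.
elim: n => [|n IH] i; first by rewrite ffunE mulg1.
rewrite iterS (twist_congruent 1 nK rh IH) twist_central // => [|j].
  by rewrite [in LHS]ffunE [in RHS]ffunE expgS mulgA mulKVg.
by apply/groupX/Lz.
Qed.

Lemma iter_twist_card h g : respects h ->
  (forall g, congruent L (twist 1 h g) g) ->
  congruent K (iter #|gT| (twist 1 h) g) g.
Proof.
move=> rh Th i; rewrite iter_twist_central // ffunE -cardsT expg_cardG ?inE //.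
by rewrite mulg1.
Qed.

End CentralStep.

(** Descend the upper central series from the whole group to the trivial one. An iterate that is
    trivial modulo one term becomes trivial modulo the next after [#|gT|] repetitions, so the total
    count stays a power of [p]. *)
Lemma iter_twist_pgroup p h : prime p -> p.-group [set: gT] -> respects h ->
  exists e, forall g, iter (p ^ e) (twist 1 h) g = g.
Proof.
move=> pr_p pG rh.
have [a cG] : exists a, #|gT| = (p ^ a)%N.
  by exists (logn p #|gT|); rewrite -cardsT; apply: card_pgroup.
have /ucnP[c Zc] := pgroup_nil pG.
suff H j : (j <= c)%N -> exists e, forall g,
    congruent 'Z_(c - j)([set: gT]) (iter (p ^ e) (twist 1 h) g) g.
  have [e He] := H c (leqnn c); exists e => g; apply/ffunP => i.
  have := He g i; rewrite subnn => /(coset_eqE _ _ (ucn_normal _ _)) /=.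
  by rewrite ucn0 inE -eq_mulVg1 => /eqP.
elim: j => [_|j IH jc].
  exists 0%N => g i; apply/coset_eqE; first exact: ucn_normal.
  by rewrite subn0 /= Zc inE.
have [e He] := IH (ltnW jc); exists (e + a)%N => g.
(* The iterate is again a twist with trivial permutation, and its conjugator still satisfies
   [respects]; the central step therefore applies to it. *)
have E g' : iter (p ^ e) (twist 1 h) g' = twist 1 (twist_pow 1 h (p ^ e)) g'.
  by rewrite -twist_powE expg1n.
rewrite expnD mulnC iterM (eq_iter E) -cG.
apply: (@iter_twist_card _ 'Z_(c - j)([set: gT])) => //.
- exact: ucn_normal.
- exact: ucn_normal.
- by rewrite -subnSK //; apply: ucn_comm.
- exact: respects_pow.
by move=> g'; rewrite -E; apply: He.
Qed.

End TwistedConjugation.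

Local Open Scope ring_scope.

(** * Finite p-groups of endomorphisms *)

Section EndoPowers.
Variables (k : fieldType) (W : vectType k).
Implicit Types f : 'End(W).

Definition lpow f n : 'End(W) := iter n (fun u => (f \o u)%VF) \1%VF.

Lemma lpowD f m n : lpow f (m + n) = (lpow f m \o lpow f n)%VF.
Proof.
elim: m => [|m IH]; first by rewrite comp_lfun1l.
by rewrite addSn /= IH comp_lfunA.
Qed.

Lemma lpowM f m n : lpow f (m * n) = lpow (lpow f m) n.
Proof.
by elim: n => [|n IH]; rewrite ?muln0 // mulnS lpowD IH.
Qed.

(** [f^-1] is a true inverse only when [f] is injective, which the finite order provides. *)
Lemma lpow_inv f n : (0 < n)%N -> lpow f n = \1%VF -> (f^-1)%VF = lpow f n.-1.
Proof.
case: n => //= n _ fn.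
have kf : lker f == 0%VS.
  apply/lker0P => x y /(congr1 (lpow f n)).
  rewrite -!comp_lfunE -[X in (_ \o X)%VF](comp_lfun1r f) -(lpowD f n 1).
  by rewrite addn1 /= fn !id_lfunE.
by rewrite -[RHS]comp_lfun1l -(lker0_compVf kf) -comp_lfunA fn comp_lfun1r.
Qed.

Section FinitePGroup.
Variables (p : nat) (S : 'End(W) -> Prop) (L : seq 'End(W)).
Hypotheses (pr_p : prime p) (SL : forall f, S f -> f \in L) (S1 : S \1%VF).
Hypothesis SM : forall f f', S f -> S f' -> S (f \o f')%VF.
Hypothesis Spow : forall f, S f -> exists e, lpow f (p ^ e) = \1%VF.

(** The list [L] gives finiteness, and inverses are positive powers. By Cauchy, a prime dividing the
    order is the order of some element, hence divides a power of [p]. *)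
Lemma finite_pgroup_of_lpow : finite_pgroup_of_endos p S.
Proof.
pose T := seq_sub [seq f <- L | `[< S f >]].
have memT f : S f -> f \in [seq f <- L | `[< S f >]].
  by move=> Sf; rewrite mem_filter SL // andbT; apply/asboolP.
have valT (x : T) : S (val x).
  by have := valP x; rewrite mem_filter => /andP[/asboolP].
pose mk f (Sf : S f) : T := SeqSub (memT f Sf).
pose one : T := mk _ S1.
pose mul (x y : T) : T := mk _ (SM (valT x) (valT y)).
have Slpow f n : S f -> S (lpow f n) by move=> Sf; elim: n => //= n; apply: SM.
have inv_ex (x : T) : exists y, mul y x = one.
  have [e xe] := Spow (valT x).
  exists (mk _ (Slpow _ (p ^ e).-1 (valT x))); apply: val_inj => /=.
  have <- := xe; rewrite -{2}(prednK (n := p ^ e)) ?expn_gt0 ?prime_gt0 //.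
  by rewrite -[in RHS]addn1 lpowD /= comp_lfun1r.
have [inv mulVx] := choice inv_ex.
have mulA : associative mul by move=> x y z; apply: val_inj; rewrite /= comp_lfunA.
have mul1 : left_id one mul by move=> x; apply: val_inj; rewrite /= comp_lfun1l.
have mul1r : right_id one mul by move=> x; apply: val_inj; rewrite /= comp_lfun1r.
pose G := Finite_isGroup.Build T mulA mul1 mulVx.
pose H : finGroupType := HB.pack T G.
exists H, (val : T -> 'End(W)); split => //.
- apply/pgroupP => r pr_r rH.
  have [x _ ox] := Cauchy pr_r rH.
  have [e xe] := Spow (valT x).
  have valX n : val (x ^+ n : H)%g = lpow (val (x : T)) n.
    by elim: n => // n IH; rewrite expgS /= -IH.
  have : (#[x]%g %| p ^ e)%N by rewrite order_dvdn; apply/eqP/val_inj; rewrite valX xe.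
  by rewrite ox Euclid_dvdX // => /andP[]; rewrite dvdn_prime2 // => /eqP ->; rewrite inE.
- exact: val_inj.
move=> f; split=> [Sf|[x ->]]; last exact: valT.
by exists (mk _ Sf).
Qed.

End FinitePGroup.
End EndoPowers.

(** * Tensor products *)

Section TensorMaps.
Variable k : fieldType.
Implicit Types U V W X Y : vectType k.

Lemma linfunP V W (f : V -> W) : linear f -> linfun f =1 f.
Proof.
move=> lf v.
pose F : {linear V -> W} := HB.pack f (GRing.isLinear.Build k _ _ _ _ lf).
by rewrite -[f]/(F : _ -> _) lfunE.
Qed.

Lemma bilin_tens_hom V W V' W' : bilin (@tens_hom k V W V' W').
Proof.
split=> f a g g'; apply: tens_ext => v w;
  by rewrite add_lfunE scale_lfunE !tens_homE add_lfunE scale_lfunE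
     ?(tensDl, tensDr).
Qed.

Lemma tensZl V W a (v : V) (w : W) : tens (a *: v) w = a *: tens v w.
Proof. exact: (GRing.scalable_linear (tensDl w)). Qed.

Lemma tensZr V W a (v : V) (w : W) : tens v (a *: w) = a *: tens v w.
Proof. exact: (GRing.scalable_linear (tensDr v)). Qed.

Lemma tens_sumr V W (I : finType) (v : V) (w : I -> W) :
  tens v (\sum_i w i) = \sum_i tens v (w i).
Proof.
transitivity (linfun (tens v : W -> tensor V W) (\sum_i w i)).
  by rewrite (linfunP (tensDr v)).
by rewrite linear_sum; apply: eq_bigr => i _; rewrite /= (linfunP (tensDr v)).
Qed.

Lemma tens_ext3 U V W X (f g : 'Hom(tensor (tensor U V) W, X)) :
  (forall u v w, f (tens (tens u v) w) = g (tens (tens u v) w)) -> f = g.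
Proof.
move=> fg; apply: tens_ext => t w.
have E (h : 'Hom(tensor (tensor U V) W, X)) :
    h (tens t w) = (h \o linfun (fun t => tens t w))%VF t.
  by rewrite comp_lfunE (linfunP (tensDl w)).
rewrite !E; congr (fun_of_lfun _ t).
by apply: tens_ext => u v; rewrite !comp_lfunE (linfunP (tensDl w)) fg.
Qed.

(** Moving the brackets back gives an explicit left inverse. *)
Lemma tens_assoc_inj U V W : lker (tens_assoc U V W) == 0%VS.
Proof.
have B u : bilin (fun v w => tens (tens u v) w : tensor (tensor U V) W).
  by split=> v a w w'; rewrite ?tensDr ?tensDl.
pose back : 'Hom(tensor U (tensor V W), tensor (tensor U V) W) :=
  tens_lift (fun u t => tens_lift (fun v w => tens (tens u v) w) t).
have backE u v w : back (tens u (tens v w)) = tens (tens u v) w.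
  rewrite tens_lift_tens ?tens_lift_tens //; split=> [z a t t'|t a z z'].
    by rewrite linearP.
  rewrite -scale_lfunE -add_lfunE; congr (fun_of_lfun _ t).
  apply: tens_ext => x y.
  by rewrite add_lfunE scale_lfunE !tens_lift_tens // !tensDl.
have K : (back \o tens_assoc U V W)%VF = \1%VF.
  by apply: tens_ext3 => u v w; rewrite comp_lfunE id_lfunE tens_assocE backE.
apply/lker0P => x y /(congr1 back).
by rewrite -!comp_lfunE K !id_lfunE.
Qed.

End TensorMaps.

(** * The grading of modules over the twisted double *)

Section Grading.
Variables (k : fieldType) (gT : finGroupType) (omega : gT -> gT -> gT -> k).
Hypothesis cocycle : normalized_cocycle omega.
Implicit Types (a b x y z : gT) (X Y Z : dspace k gT).

Lemma cocycle_neq0 a b c : omega a b c != 0.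
Proof. by have [nz _ _] := cocycle; exact: nz. Qed.

Lemma cocycle1l a b : omega 1%g a b = 1.
Proof. by have [_ _ /(_ a b)[]] := cocycle. Qed.

Lemma cocycle1m a b : omega a 1%g b = 1.
Proof. by have [_ _ /(_ a b)[]] := cocycle. Qed.

Lemma cocycle1r a b : omega a b 1%g = 1.
Proof. by have [_ _ /(_ a b)[]] := cocycle. Qed.

Lemma theta1 x g : theta omega x g 1 = 1.
Proof. by rewrite /theta !cocycle1r cocycle1m invr1 !mulr1. Qed.

Lemma theta1l x g : theta omega x 1 g = 1.
Proof. by rewrite /theta !cocycle1l cocycle1m invr1 !mulr1. Qed.

Lemma gamma1 y z : gamma omega 1 y z = 1.
Proof. by rewrite /gamma cocycle1r cocycle1m cocycle1l invr1 !mulr1. Qed.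

(** Membership in the component of degree [x], phrased through the action of every [ddelta] so that
    it applies to tensor powers without the module axioms for them. Zero is homogeneous of every
    degree. *)
Definition homog X x (v : X) : Prop :=
  forall y, dact X (ddelta k y) v = (y == x)%:R *: v.

Lemma dact2E X Y s t :
  dact2 X Y (tens s t) = tens_hom (dact X s) (dact Y t).
Proof.
rewrite /dact2 tens_lift_tens //.
have [br bl] := @bilin_tens_hom k X Y X Y.
by split=> s' a t1 t2; rewrite linearP (br, bl).
Qed.

Lemma dact3E X Y Z s t :
  dact3 X Y Z (tens s t) = tens_hom (dact2 X Y s) (dact Z t).
Proof.
rewrite /dact3 tens_lift_tens //.
have [br bl] := @bilin_tens_hom k (tensor X Y) Z (tensor X Y) Z.
by split=> s' a t1 t2; rewrite linearP (br, bl).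
Qed.

Lemma homogZ X x (a : k) (v : X) : homog x v -> homog x (a *: v).
Proof. by move=> hv y; rewrite linearZ /= hv !scalerA mulrC. Qed.

(** By [gamma1], the coproduct of [ddelta z] is the plain sum of [ddelta a] tensor [ddelta b] over
    [a * b = z]. *)
Lemma homog_tens X Y x y (v : X) (w : Y) :
  homog x v -> homog y w -> homog (X := dtensor omega X Y) (x * y)%g (tens v w).
Proof.
move=> hv hw z.
rewrite /= comp_lfunE /dcoprod double_liftE linear_sum sum_lfunE.
rewrite (eq_bigr (fun u : gT * gT => (u == (x, y))%:R *: tens v w)); last first.
  move=> -[a b] _; rewrite linearZ /= scale_lfunE dact2E tens_homE hv hw gamma1.
  by rewrite scale1r tensZl tensZr scalerA -natrM mulnb xpair_eqE.
case: eqP => [->|ne].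
  rewrite (bigD1 (x, y)) //= eqxx scale1r big1 ?addr0 // => u /andP[_ /negPf ->].
  by rewrite scale0r.
rewrite scale0r big1 // => u /eqP e; case: eqP => [eu|]; last by rewrite scale0r.
by case: ne; rewrite -e eu.
Qed.

Lemma braiding_homog X Y x (v : X) (w : Y) : homog x v ->
  braiding X Y (tens v w) = tens (dact Y (dbar k x) w) v.
Proof.
move=> hv; rewrite /braiding comp_lfunE linear_sum sum_lfunE (bigD1 x) //=.
rewrite dact2E tens_homE hv eqxx scale1r big1 ?addr0 ?tens_flipE // => y /negPf ne.
by rewrite dact2E tens_homE hv ne tensZl scale0r.
Qed.


(** Arbitrary coefficients serve two cases: the inverse of [omega] gives the action of [Phi], and
    [omega] itself gives the operator inverting it. *)
Definition associator_scale (f : gT -> gT -> gT -> k) X Y Z :=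
  dact3 X Y Z (\sum_a \sum_b \sum_c f a b c *:
    tens (tens (ddelta k a) (ddelta k b)) (ddelta k c)).

Lemma associator_scale_homog (f : gT -> gT -> gT -> k) X Y Z a b c
    (u : X) (v : Y) (w : Z) :
  homog a u -> homog b v -> homog c w ->
  associator_scale f X Y Z (tens (tens u v) w) = f a b c *: tens (tens u v) w.
Proof.
move=> hu hv hw; rewrite /associator_scale linear_sum sum_lfunE.
have E a' b' c' : dact3 X Y Z (f a' b' c' *:
      tens (tens (ddelta k a') (ddelta k b')) (ddelta k c')) (tens (tens u v) w) =
    ((a' == a)%:R * (b' == b)%:R * (c' == c)%:R * f a' b' c') *:
      tens (tens u v) w.
  rewrite linearZ /= scale_lfunE dact3E tens_homE dact2E tens_homE hu hv hw.
  by rewrite !(tensZl, tensZr) !scalerA; congr (_ *: _); ring.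
rewrite (bigD1 a) //= [X in _ + X]big1 ?addr0; last first.
  move=> a' /negPf ne; rewrite linear_sum sum_lfunE big1 // => b' _.
  rewrite linear_sum sum_lfunE big1 // => c' _.
  by rewrite E ne !mul0r scale0r.
rewrite linear_sum sum_lfunE (bigD1 b) //= [X in _ + X]big1 ?addr0; last first.
  move=> b' /negPf ne; rewrite linear_sum sum_lfunE big1 // => c' _.
  by rewrite E ne !(mul0r, mulr0) scale0r.
rewrite linear_sum sum_lfunE (bigD1 c) //= [X in _ + X]big1 ?addr0; last first.
  by move=> c' /negPf ne; rewrite E ne !(mul0r, mulr0) scale0r.
by rewrite E !eqxx !mul1r.
Qed.

Lemma associator_homog X Y Z a b c (u : X) (v : Y) (w : Z) :
  homog a u -> homog b v -> homog c w ->
  associator omega X Y Z (tens (tens u v) w) =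
    (omega a b c)^-1 *: tens u (tens v w).
Proof.
move=> hu hv hw; rewrite /associator comp_lfunE.
rewrite -[Phi _]/(\sum_a \sum_b \sum_c (omega a b c)^-1 *: _).
rewrite -/(associator_scale (fun a b c => (omega a b c)^-1) X Y Z).
by rewrite (associator_scale_homog _ hu hv hw) linearZ /= tens_assocE.
Qed.

(** * Powers of the cocycle as coboundaries *)

Definition mu a b : k := \prod_c omega a b c.

Lemma mu_neq0 a b : mu a b != 0.
Proof. by apply/prodf_neq0 => c _; apply: cocycle_neq0. Qed.

Lemma mu1l a : mu 1 a = 1.
Proof. by apply: big1 => c _; apply: cocycle1l. Qed.

Lemma mu1r a : mu a 1 = 1.
Proof. by apply: big1 => c _; apply: cocycle1m. Qed.

(* Multiply the cocycle identity over its last variable. *)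
Lemma omega_exp a b c : omega a b c ^+ #|gT| =
  mu (a * b)%g c * mu a b / (mu a (b * c)%g * mu b c).
Proof.
have [_ coc _] := cocycle.
have E : \prod_d (omega a b c * omega a (b * c)%g d * omega b c d) =
    \prod_d (omega (a * b)%g c d * omega a b (c * d)%g).
  by apply: eq_bigr => d _; apply: coc.
move: E; rewrite !big_split /= prodr_const -/(mu _ _) -/(mu _ _) -/(mu _ _).
(* The substitution of [c * d] for [d] turns the last product into [mu a b]. *)
rewrite -(reindex_inj (mulgI c) (P := xpredT) (F := omega a b)) /= -/(mu a b) => <-.
by rewrite -mulrA mulfK // mulf_neq0 // mu_neq0.
Qed.

(* The coboundary that [theta_exp] splits off from [theta ^+ #|gT|]; its root
   rescales the action of [bar a] on the component of degree [x]. *)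
Definition kappa a x : k := mu a x / mu (x ^ a^-1)%g a.

Lemma kappa_neq0 a x : kappa a x != 0.
Proof. by rewrite mulf_neq0 ?invr_eq0 ?mu_neq0. Qed.

Lemma kappa1 x : kappa 1 x = 1.
Proof. by rewrite /kappa mu1l mu1r invr1 mulr1. Qed.

(** Expand by [omega_exp]. With [y] and [z] the degrees after [a * b] and after [b], the relations
    [y * a = a * z] and [z * b = b * x] cancel the mixed values of [mu]; what is left is a
    coboundary of [kappa]. *)
Lemma theta_exp x a b : theta omega (x ^ (a * b)^-1)%g a b ^+ #|gT| =
  kappa (a * b)%g x / (kappa a (x ^ b^-1)%g * kappa b x).
Proof.
set y := (x ^ (a * b)^-1)%g; set z := (x ^ b^-1)%g.
have ya : (y ^ a)%g = z by rewrite /y invMg conjgM conjgKV.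
have yab : (y ^ (a * b))%g = x by rewrite /y conjgKV.
have zy : (z ^ a^-1)%g = y by rewrite -ya conjgK.
have eya : (y * a = a * z)%g by rewrite -ya conjgC.
have ezb : (z * b = b * x)%g by rewrite /z [RHS]conjgCV.
rewrite /theta yab ya !exprMn exprVn !omega_exp /kappa -/y -/z zy eya ezb.
by field; rewrite ?mu_neq0.
Qed.

(** * The action on homogeneous vectors of a module *)

Section Module.
Variable V : dspace k gT.
Hypothesis modV : is_module omega V.

Definition rho a : 'End(V) := dact V (dbar k a).

Lemma dact_dbas_mul x g y h (v : V) :
  dact V (dbas k x g) (dact V (dbas k y h) v) =
  (theta omega x g h * (x == y ^ g^-1)%g%:R) *: dact V (dbas k x (g * h)%g) v.
Proof.
have [_ modM] := modV.
by rewrite -comp_lfunE -modM dmul_dbas linearZ scale_lfunE conjgE invgK mulgA.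
Qed.

Lemma homog_ddelta x (v : V) : homog x (dact V (ddelta k x) v).
Proof.
move=> y; rewrite /ddelta dact_dbas_mul theta1 mul1r invg1 conjg1 mulg1.
by case: eqP => [->|] //; rewrite !scale0r.
Qed.

Lemma sum_ddelta (v : V) : v = \sum_x dact V (ddelta k x) v.
Proof.
have [mod1 _] := modV.
by rewrite -{1}[v]id_lfunE -mod1 linear_sum sum_lfunE.
Qed.

(** Replace [v] by [ddelta x] acting on [v]: the product in the double vanishes unless [y] is the
    conjugate of [x], so [rho a] retains a single summand. *)
Lemma dact_dbas_homog x y a (v : V) : homog x v ->
  dact V (dbas k y a) v = (y == x ^ a^-1)%g%:R *: rho a v.
Proof.
move=> hv.
have E z : dact V (dbas k z a) v = (z == x ^ a^-1)%g%:R *: dact V (dbas k z a) v.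
  rewrite -{1}[v](_ : dact V (ddelta k x) v = _); last by rewrite hv eqxx scale1r.
  by rewrite dact_dbas_mul theta1 mul1r mulg1.
rewrite E /rho linear_sum sum_lfunE (bigD1 (x ^ a^-1)%g) //= [X in _ + X]big1.
  by rewrite addr0; case: eqP => [->|] //; rewrite !scale0r.
by move=> z /negPf ne; rewrite E ne scale0r.
Qed.

Lemma rho_homog x a (v : V) : homog x v -> homog (x ^ a^-1)%g (rho a v).
Proof.
move=> hv y.
have <- : dact V (dbas k (x ^ a^-1)%g a) v = rho a v.
  by rewrite (dact_dbas_homog _ _ hv) eqxx scale1r.
rewrite /ddelta dact_dbas_mul theta1l mul1r invg1 conjg1 mul1g.
by case: eqP => [->|] //; rewrite !scale0r.
Qed.

Lemma rho1 (v : V) : rho 1%g v = v.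
Proof. by have [mod1 _] := modV; rewrite /rho [dact V _]mod1 id_lfunE. Qed.

Lemma rhoM x a b (v : V) : homog x v ->
  rho a (rho b v) = theta omega (x ^ (a * b)^-1)%g a b *: rho (a * b)%g v.
Proof.
move=> hv.
have E y c (w : V) : homog y w -> rho c w = dact V (dbas k (y ^ c^-1)%g c) w.
  by move=> hw; rewrite (dact_dbas_homog _ _ hw) eqxx scale1r.
rewrite (E _ _ _ (rho_homog b hv)) (E _ b _ hv) (E _ (a * b)%g _ hv).
by rewrite dact_dbas_mul invMg conjgM eqxx mulr1.
Qed.

(** * Homogeneous tensors and the Hurwitz move *)

Fixpoint tvec m (v : nat -> V) : tpower omega V m :=
  match m return tpower omega V m with
  | 0 => v 0
  | m'.+1 => tens (tvec m' v) (v m'.+1)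
  end.

Fixpoint gprod m (g : nat -> gT) : gT :=
  if m is m'.+1 then (gprod m' g * g m)%g else g 0%N.

Lemma tvec_homog m g v : (forall i, homog (g i) (v i)) ->
  homog (gprod m g) (tvec m v).
Proof. by move=> hv; elim: m => [|m IH] //=; apply: homog_tens. Qed.

Lemma eq_tvec m v v' : (forall i, (i <= m)%N -> v i = v' i) ->
  tvec m v = tvec m v'.
Proof.
elim: m => [|m IH] e /=; first exact: e.
by rewrite e // IH // => i im; apply/e/leqW.
Qed.

Lemma eq_gprod m g g' : (forall i, (i <= m)%N -> g i = g' i) ->
  gprod m g = gprod m g'.
Proof.
elim: m => [|m IH] e /=; first exact: e.
by rewrite e // IH // => i im; apply/e/leqW.
Qed.

(** Each factor is a sum of homogeneous vectors. The induction fixes a homogeneous last factor and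
    compares two maps on the remaining ones. *)
Lemma tvec_ext m (W : vectType k) (f f' : 'Hom(tpower omega V m, W)) :
  (forall g v, (forall i, homog (g i) (v i)) -> f (tvec m v) = f' (tvec m v)) ->
  f = f'.
Proof.
elim: m W f f' => [|m IH] W f f' ff'.
  apply/lfunP => v; rewrite (sum_ddelta v) !linear_sum; apply: eq_bigr => x _.
  by apply: (ff' (fun=> x) (fun=> _)) => _; apply: homog_ddelta.
refine (@tens_ext k W (tpower omega V m) V f f' _) => t w.
rewrite (sum_ddelta w) tens_sumr !linear_sum.
apply: eq_bigr => x _; set w' := dact V _ w.
have hw' : homog x w' by apply: homog_ddelta.
have E (h : 'Hom(tpower omega V m.+1, W)) :
    h (tens t w') = (h \o linfun (fun t => tens t w'))%VF t.
  by rewrite comp_lfunE (linfunP (tensDl w')).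
rewrite [LHS]E [RHS]E; congr (fun_of_lfun _ t); apply: IH => g v hv.
rewrite !comp_lfunE (linfunP (tensDl w')).
(* Both sequences are constant past [m], so homogeneity holds at every natural index, not only up to
   [m.+1]. *)
pose g' i := if (i <= m)%N then g i else x.
pose v' i := if (i <= m)%N then v i else w'.
have -> : tens (tvec m v) w' = tvec m.+1 v'.
  rewrite /= {2}/v' ltnn; congr (tens _ _).
  by apply: eq_tvec => i im; rewrite /v' im.
by apply: (ff' g') => i; rewrite /g' /v'; case: ifP.
Qed.

(** Needed because [braid_last] uses the inverse of the associator. The action of [Phi] is undone by
    the same sum with coefficients [omega], and rebracketing is injective. *)
Lemma associator_inj m : lker (associator omega (tpower omega V m) V V) == 0%VS.
Proof.
set X := tpower omega V m; set al := associator omega X V V.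
pose S := associator_scale omega X V V.
have K : (S \o dact3 X V V (Phi omega))%VF = \1%VF.
  apply: (@tvec_ext m.+2) => g v hv.
  rewrite comp_lfunE id_lfunE.
  rewrite -[Phi _]/(\sum_a \sum_b \sum_c (omega a b c)^-1 *: _).
  rewrite -/(associator_scale (fun a b c => (omega a b c)^-1) X V V).
  have hm := tvec_homog m hv.
  rewrite (associator_scale_homog _ hm (hv _) (hv _)) linearZ /=.
  rewrite (associator_scale_homog _ hm (hv _) (hv _)) scalerA mulVf ?scale1r //.
  exact: cocycle_neq0.
apply/lker0P => s t; rewrite /al /associator !comp_lfunE.
move=> /(lker0P (tens_assoc_inj _ _ _)).
by move=> /(congr1 S); rewrite -!comp_lfunE K !id_lfunE.
Qed.

(* The scalar that the associators of the left bracketing accumulate once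
   [omega ^+ #|gT|] is replaced by the coboundary of [mu]. *)
Fixpoint mutower m (g : nat -> gT) : k :=
  if m is m'.+1 then mutower m' g * mu (gprod m' g) (g m) else 1.

Lemma mutower_neq0 m g : mutower m g != 0.
Proof. by elim: m => [|m IH] /=; rewrite ?oner_eq0 // mulf_neq0 // mu_neq0. Qed.

Lemma eq_mutower m g g' : (forall i, (i <= m)%N -> g i = g' i) ->
  mutower m g = mutower m g'.
Proof.
elim: m => [//|m IH] e /=.
rewrite e // (@eq_gprod m g g') ?IH // => i im; exact/e/leqW.
Qed.

Definition hurwitz i (g : nat -> gT) j : gT :=
  if j == i then (g i.+1 ^ (g i)^-1)%g else if j == i.+1 then g i else g j.

Definition hurwitzv i (g : nat -> gT) (v : nat -> V) j : V :=
  if j == i then rho (g i) (v i.+1) else if j == i.+1 then v i else v j.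

Lemma hurwitz_lt i j g : (j < i)%N -> hurwitz i g j = g j.
Proof. by move=> ji; rewrite /hurwitz !ltn_eqF // ltnW. Qed.

Lemma hurwitzv_lt i j g v : (j < i)%N -> hurwitzv i g v j = v j.
Proof. by move=> ji; rewrite /hurwitzv !ltn_eqF // ltnW. Qed.

Lemma hurwitz_gt i j g : (i.+1 < j)%N -> hurwitz i g j = g j.
Proof. by move=> ji; rewrite /hurwitz !gtn_eqF // ltnW. Qed.

Lemma hurwitzv_gt i j g v : (i.+1 < j)%N -> hurwitzv i g v j = v j.
Proof. by move=> ji; rewrite /hurwitzv !gtn_eqF // ltnW. Qed.

Lemma hurwitz0 i g : hurwitz i g i = (g i.+1 ^ (g i)^-1)%g.
Proof. by rewrite /hurwitz eqxx. Qed.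

Lemma hurwitz1 i g : hurwitz i g i.+1 = g i.
Proof. by rewrite /hurwitz eqxx gtn_eqF. Qed.

Lemma hurwitzv0 i g v : hurwitzv i g v i = rho (g i) (v i.+1).
Proof. by rewrite /hurwitzv eqxx. Qed.

Lemma hurwitzv1 i g v : hurwitzv i g v i.+1 = v i.
Proof. by rewrite /hurwitzv eqxx gtn_eqF. Qed.

Lemma gprod_hurwitz m i g : (i < m)%N -> gprod m (hurwitz i g) = gprod m g.
Proof.
elim: m => [//|m IH]; rewrite ltnS leq_eqVlt => /predU1P[->|im] /=; last first.
  by rewrite IH // hurwitz_gt.
rewrite hurwitz1.
case: m {IH} => [|m] /=; first by rewrite hurwitz0 conjgE invgK !mulgA mulgVK.
rewrite hurwitz0 (@eq_gprod m _ g) => [|j jm]; last by rewrite hurwitz_lt.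
by rewrite conjgE invgK !mulgA mulgVK.
Qed.

(** The scalar comes from the associators alone and depends only on the degrees. Its power is
    computed by [omega_exp], whose [mu] factors regroup into a ratio of [mutower] values and the
    [kappa] that will normalize [rho]. *)
Lemma braid_op_tvec m i g : (i < m)%N ->
  exists2 c, c ^+ #|gT| =
      mutower m (hurwitz i g) / mutower m g * kappa (g i) (g i.+1)
    & forall v, (forall j, homog (g j) (v j)) ->
      braid_op omega V m i (tvec m v) = c *: tvec m (hurwitzv i g v).
Proof.
elim: m => [//|m IH]; rewrite ltnS leq_eqVlt => /predU1P[->|im].
  case: m {IH} => [|m].
    (* The first two factors are braided without any associator. *)
    exists 1; last by move=> v hv; rewrite /= (braiding_homog _ (hv 0%N)) scale1r.
    rewrite /= !mul1r expr1n hurwitz0 hurwitz1 /kappa.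
    by field; rewrite !mu_neq0.
  set x := gprod m g; set a := g m.+1; set b := g m.+2.
  (* The denominator comes from the associator applied before the braiding, the numerator from its
     inverse applied to the new degrees. *)
  exists (omega x (b ^ a^-1)%g a / omega x a b).
    rewrite exprMn exprVn !omega_exp /= hurwitz1 hurwitz0 -/a -/b.
    rewrite (@eq_gprod m _ g) => [|j jm]; last by rewrite hurwitz_lt.
    rewrite (@eq_mutower m _ g) => [|j jm]; last by rewrite hurwitz_lt.
    rewrite -/x -/a (_ : b ^ a^-1 * a = a * b)%g; last by rewrite conjgE invgK !mulgA mulgVK.
    by rewrite /kappa; field; rewrite !mu_neq0 mutower_neq0.
  move=> v hv; have hx := tvec_homog m hv.
  rewrite [braid_op _ _ _ _]/= ltnn /braid_last.
  set al := associator _ _ _ _.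
  have alE := associator_homog hx (hv m.+1) (hv m.+2).
  rewrite 2!comp_lfunE [al _]alE linearZ /=.
  rewrite tens_homE id_lfunE (braiding_homog _ (hv _)) linearZ /=.
  rewrite mulrC -scalerA; congr (_ *: _).
  have hb := rho_homog a (hv m.+2).
  apply: (canLR (lker0_lfunK (associator_inj m))).
  rewrite linearZ /= hurwitzv0 hurwitzv1.
  rewrite (@eq_tvec m _ v) => [|j jm]; last by rewrite hurwitzv_lt.
  rewrite (associator_homog hx hb (hv _)) scalerA divff ?scale1r //.
  exact: cocycle_neq0.
have [c cq E] := IH im; exists c.
  rewrite cq /= gprod_hurwitz // hurwitz_gt //.
  by field; rewrite mu_neq0 mutower_neq0.
by move=> v hv; rewrite /= im tens_homE id_lfunE E // tensZl hurwitzv_gt.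
Qed.

(** * Monomial operators up to roots of unity *)

Section Monomial.
(** An arbitrary choice of roots, not assumed multiplicative; identities between roots are used only
    up to [torsion] scalars. *)
Variable rt : k -> k.
Hypotheses (rtX : forall x : k, rt x ^+ #|gT| = x) (rt1 : rt 1 = 1).

Definition torsion (c : k) : Prop := c ^+ #|gT| = 1.

Lemma torsion1 : torsion 1.
Proof. exact: expr1n. Qed.

Lemma torsionM c d : torsion c -> torsion d -> torsion (c * d).
Proof. by rewrite /torsion exprMn => -> ->; rewrite mulr1. Qed.

Lemma rt_neq0 (x : k) : x != 0 -> rt x != 0.
Proof.
move=> x0; apply: contra_neq x0 => r0.
by rewrite -[x]rtX r0 expr0n gtn_eqF // -cardsT cardG_gt0.
Qed.

Definition nrho a : 'End(V) :=
  \sum_x rt (kappa a x) *: (rho a \o dact V (ddelta k x))%VF.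

Lemma nrho_homogE x a (v : V) : homog x v -> nrho a v = rt (kappa a x) *: rho a v.
Proof.
move=> hv; rewrite /nrho sum_lfunE (bigD1 x) //= [X in _ + X]big1 => [|y /negPf ne].
  by rewrite addr0 scale_lfunE comp_lfunE hv eqxx scale1r.
by rewrite scale_lfunE comp_lfunE hv ne scale0r linear0 scaler0.
Qed.

Lemma nrho_homog x a (v : V) : homog x v -> homog (x ^ a^-1)%g (nrho a v).
Proof. by move=> hv; rewrite (nrho_homogE a hv); apply/homogZ/rho_homog. Qed.

Lemma nrho1 x (v : V) : homog x v -> nrho 1%g v = v.
Proof. by move=> hv; rewrite (nrho_homogE _ hv) kappa1 rt1 scale1r rho1. Qed.

(** In the power of the scalar, the [kappa] values introduced by the rescaling cancel those given by
    [theta_exp]. *)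
Lemma nrhoM x a b : exists2 c, torsion c &
  forall v : V, homog x v -> nrho a (nrho b v) = c *: nrho (a * b)%g v.
Proof.
exists (rt (kappa a (x ^ b^-1)%g) * rt (kappa b x) / rt (kappa (a * b)%g x) *
    theta omega (x ^ (a * b)^-1)%g a b).
  rewrite /torsion exprMn theta_exp !exprMn exprVn !rtX.
  by field; rewrite !kappa_neq0.
move=> v hv; rewrite (nrho_homogE a (nrho_homog b hv)) !(nrho_homogE _ hv) linearZ /=.
rewrite (rhoM _ _ hv) !scalerA; congr (_ *: _).
by field; rewrite rt_neq0 // kappa_neq0.
Qed.

Lemma tvec_scale m (c : nat -> k) v v' :
  (forall j, (j <= m)%N -> v j = c j *: v' j) ->
  tvec m v = (\prod_(j < m.+1) c j) *: tvec m v'.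
Proof.
elim: m => [|m IH] e /=; first by rewrite big_ord_recl big_ord0 mulr1 e.
rewrite e // (IH (fun j jm => e j (leqW jm))) tensZl tensZr scalerA.
by rewrite [in RHS]big_ord_recr.
Qed.

Section Power.
Variable m : nat.
Implicit Types (g : {ffun 'I_m.+1 -> gT}) (s : {perm 'I_m.+1})
  (h : {ffun 'I_m.+1 -> gT} -> 'I_m.+1 -> gT).

(** Links finite tuples, which can be enumerated and permuted, to the sequences used in recursion on
    [m]. Indices past [m] repeat the value at 0, so homogeneity extends to all of them. *)
Definition nat_ext T (g : 'I_m.+1 -> T) (j : nat) : T := g (inord j).

Definition hvec g (v : 'I_m.+1 -> V) : Prop := forall i, homog (g i) (v i).

Definition ntens g v : tpower omega V m :=
  rt (mutower m (nat_ext g)) *: tvec m (nat_ext v).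

Lemma ntens_scale g (c : 'I_m.+1 -> k) v v' : (forall i, v i = c i *: v' i) ->
  ntens g v = (\prod_i c i) *: ntens g v'.
Proof.
move=> vv'; rewrite /ntens (tvec_scale (c := nat_ext c) (v' := nat_ext v')) => [|j _].
  rewrite !scalerA mulrC; congr (_ * _ *: _).
  by apply: eq_bigr => i _; rewrite /nat_ext inord_val.
exact: vv'.
Qed.

Lemma ntens_ext (f f' : 'End(tpower omega V m)) :
  (forall g v, hvec g v -> f (ntens g v) = f' (ntens g v)) -> f = f'.
Proof.
move=> ff'; apply: tvec_ext => g v hv.
pose G := [ffun i : 'I_m.+1 => g i].
have -> : tvec m v = (rt (mutower m (nat_ext G)))^-1 *: ntens G (fun i => v i).
  rewrite /ntens scalerA mulVf ?rt_neq0 ?mutower_neq0 // scale1r.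
  by apply: eq_tvec => j jm; rewrite /nat_ext inordK.
by rewrite [LHS]linearZ [RHS]linearZ; congr (_ *: _); apply: ff' => i; rewrite ffunE.
Qed.

Definition monomial_at g (f : 'End(tpower omega V m)) s h (c : k) : Prop :=
  forall v, hvec g v ->
    f (ntens g v) = c *: ntens (twist s h g) (fun i => nrho (h g i) (v (s i))).

Definition monomial f s h : Prop :=
  forall g, exists2 c, torsion c & monomial_at g f s h c.

Lemma hvec_twist s h g v : hvec g v ->
  hvec (twist s h g) (fun i => nrho (h g i) (v (s i))).
Proof. by move=> hv i; rewrite ffunE; apply: nrho_homog. Qed.

(** Merging the two actions on each factor costs one scalar from [nrhoM]; the product of these
    scalars is still torsion. *)
Lemma monomial_comp f1 s1 h1 f2 s2 h2 : monomial f1 s1 h1 -> monomial f2 s2 h2 ->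
  monomial (f2 \o f1)%VF (s2 * s1)%g (twist_comp s1 h1 s2 h2).
Proof.
move=> m1 m2 g; have [c1 t1 e1] := m1 g; have [c2 t2 e2] := m2 (twist s1 h1 g).
have /choice[c cP] i : exists c, torsion c /\
    forall v, homog (g (s1 (s2 i))) v ->
      nrho (h2 (twist s1 h1 g) i) (nrho (h1 g (s2 i)) v) =
      c *: nrho (twist_comp s1 h1 s2 h2 g i) v.
  by have [c] := nrhoM (g (s1 (s2 i))) (h2 (twist s1 h1 g) i) (h1 g (s2 i)); exists c.
exists (c1 * c2 * \prod_i c i).
  apply: torsionM; first exact: torsionM.
  by apply: big_ind => [||i _]; [exact: torsion1 | exact: torsionM | case: (cP i)].
move=> v hv; rewrite comp_lfunE e1 // linearZ /= e2; last exact: hvec_twist.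
rewrite scalerA -[RHS]scalerA twist_compE; congr (_ *: _).
apply: ntens_scale => i; rewrite permM.
by case: (cP i) => _ ->.
Qed.

Lemma monomial_id f (g : {ffun 'I_m.+1 -> gT}) c v : hvec g v ->
  monomial_at g f 1 (fun _ _ => 1%g) c -> f (ntens g v) = c *: ntens g v.
Proof.
move=> hv ->; rewrite ?twist1 //; congr (_ *: ntens _ _).
by apply/funext => i; rewrite perm1 (nrho1 (hv i)).
Qed.

Lemma monomial1 : monomial \1%VF 1 (fun _ _ => 1%g).
Proof.
move=> g; exists 1; first exact: torsion1.
move=> v hv; rewrite twist1 scale1r id_lfunE; congr (ntens _ _).
by apply/funext => i; rewrite perm1 (nrho1 (hv i)).
Qed.

Lemma monomial_lpow f s h n : monomial f s h ->
  monomial (lpow f n) (s ^+ n)%g (twist_pow s h n).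
Proof.
move=> mf; elim: n => [|n IH]; first exact: monomial1.
by rewrite expgS; apply: monomial_comp.
Qed.

(** The [N]-th power fixes all degrees and positions. One factor [#|gT|] kills the group elements
    acting on the tensor factors, leaving a torsion scalar on each component; the second factor
    kills that scalar. *)
Lemma monomial_order f s h N : monomial f s h -> (s ^+ N = 1)%g ->
  (forall g, iter N (twist s h) g = g) -> lpow f (N * #|gT| * #|gT|) = \1%VF.
Proof.
move=> mf sN TN; rewrite lpowM [lpow f _]lpowM.
have := monomial_lpow N mf; set h' := twist_pow s h N; rewrite sN => mfN.
have Th' g : twist 1 h' g = g by rewrite -sN twist_powE TN.
have := monomial_lpow #|gT| mfN; rewrite expg1n.
rewrite (_ : twist_pow 1 h' _ = fun _ _ => 1%g); last first.
  apply/funext => g; apply/funext => i.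
  by rewrite twist_pow_fix // -cardsT expg_cardG ?inE.
set f2 := lpow (lpow f N) _ => mf2.
apply: ntens_ext => g v hv; have [c tc cE] := mf2 g.
suff -> n : lpow f2 n (ntens g v) = c ^+ n *: ntens g v.
  by rewrite tc scale1r id_lfunE.
elim: n => [|n IH]; first by rewrite id_lfunE scale1r.
by rewrite /= comp_lfunE IH linearZ /= (monomial_id hv cE) scalerA exprSr.
Qed.

(** An injective twist of a finite set has finite order, hence so does [f], and its inverse is one
    of its positive powers. *)
Lemma monomial_inv f s h : monomial f s h -> respects h ->
  injective (twist s h) -> (s * s = 1)%g ->
  exists h', [/\ respects h', injective (twist s h') & monomial (f^-1)%VF s h'].
Proof.
move=> mf rh injT ss.
(* The factor 2 makes the involution [s] trivial at exponent [N] as well. *)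
pose t := perm injT; pose N := (#[t]%g * 2)%N.
have tE n g : iter n (twist s h) g = (t ^+ n)%g g.
  elim: n => [|n IH]; first by rewrite perm1.
  by rewrite iterS IH expgSr permM permE.
have TN g : iter N (twist s h) g = g.
  by rewrite tE /N expgM expg_order expg1n perm1.
have sN : (s ^+ N = 1)%g by rewrite /N mulnC expgM expgS expg1 ss expg1n.
set M := (N * #|gT| * #|gT|)%N.
have fM : lpow f M = \1%VF by apply: monomial_order mf sN TN.
have M0 : (0 < M)%N.
  by rewrite /M /N !muln_gt0 order_gt0 -cardsT cardG_gt0.
have sM : (s ^+ M.-1 = s)%g.
  have : (s ^+ M = 1)%g by rewrite /M 2!expgM sN !expg1n.
  rewrite -(prednK M0) expgS => /eqP; rewrite -eq_invg_mul => /eqP <-.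
  by apply/eqP; rewrite eq_invg_mul ss.
exists (twist_pow s h M.-1); split.
- exact: respects_pow.
- move=> g g'; rewrite -{1 3}sM !twist_powE => e.
  elim: (M.-1) e => //= n IH /injT; exact: IH.
by rewrite (lpow_inv M0 fM) -{1}sM; apply: monomial_lpow.
Qed.

(** By [ntens_ext] an operator is determined by its permutation, conjugators and scalars, which
    range over a finite type. *)
Lemma monomial_finite (roots : seq k) : (forall c, torsion c -> c \in roots) ->
  exists L : seq 'End(tpower omega V m), forall f s h, monomial f s h -> f \in L.
Proof.
move=> rootsP.
pose I := {ffun 'I_m.+1 -> gT}.
pose D := ({perm 'I_m.+1} * {ffun I -> I} * {ffun I -> seq_sub roots})%type.
pose P f (d : D) :=
  forall g, monomial_at g f d.1.1 (fun g i => d.1.2 g i) (val (d.2 g)).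
(* [F] picks the operator described by [d], with the identity as default when there is none. *)
have /choice[F FP] (d : D) : exists f, forall f', P f' d -> f' = f.
  have [[f Pf]|nP] := pselect (exists f, P f d); last first.
    by exists \1%VF => f' Pf'; case: nP; exists f'.
  by exists f => f' Pf'; apply: ntens_ext => g v hv; rewrite Pf // Pf'.
exists (map F (enum {: D})) => f s h mf.
have /choice[c cP] g : exists c : seq_sub roots, monomial_at g f s h (val c).
  by have [c tc mc] := mf g; exists (SeqSub (rootsP c tc)).
pose d : D := (s, [ffun g => [ffun i => h g i]], finfun c).
rewrite (FP d f) ?map_f ?mem_enum // => g.
rewrite /= ffunE (_ : (fun g i => _) = h) //.
by apply/funext => g'; apply/funext => i; rewrite !ffunE.
Qed.

End Power.

(** * Operators of braid words *)

Section Words.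
Variable m : nat.
Implicit Types (i : 'I_m.+1.-1) (l : braid_letter m.+1) (w : braid_word m.+1).

(** The vector arriving at position [i] is acted on by the old degree at that position; all other
    vectors are only moved. *)
Definition hurwitz_conj i (g : {ffun 'I_m.+1 -> gT}) (j : 'I_m.+1) : gT :=
  if val j == i then g j else 1%g.

Lemma respects_hurwitz_conj i : respects (hurwitz_conj i).
Proof. by move=> K nK g g' gg' j; rewrite /hurwitz_conj; case: ifP. Qed.

Lemma inord_strand i : inord i = strand i :> 'I_m.+1.
Proof. by apply: val_inj; rewrite /= inordK //; exact: ltnW (@strand_proof m.+1 i). Qed.

Lemma inord_next_strand i : inord i.+1 = next_strand i :> 'I_m.+1.
Proof. by apply: val_inj; rewrite /= inordK //; exact: (@strand_proof m.+1 i). Qed.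

Lemma swap_out i (j : 'I_m.+1) : val j != i -> val j != i.+1 -> swap i j = j.
Proof. by move=> ji ji1; rewrite tpermD // eq_sym -val_eqE. Qed.

Lemma nat_ext_twist_swap i g j : (j <= m)%N ->
  nat_ext (twist (swap i) (hurwitz_conj i) g) j = hurwitz i (nat_ext g) j.
Proof.
move=> jm; rewrite /nat_ext /hurwitz ffunE /hurwitz_conj /= inordK //.
case: eqP => [->|/eqP ji]; first by rewrite inord_strand tpermL inord_next_strand.
rewrite invg1 conjg1; case: eqP => [->|/eqP ji1].
  by rewrite inord_next_strand tpermR inord_strand.
by rewrite swap_out /= ?inordK.
Qed.

Lemma twist_swap_inj i : injective (twist (swap i) (hurwitz_conj i)).
Proof.
move=> g g' e.
have E j : (j <= m)%N -> hurwitz i (nat_ext g) j = hurwitz i (nat_ext g') j.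
  by move=> jm; rewrite -!nat_ext_twist_swap // e.
have im : (i < m)%N by exact: ltn_ord.
have gi : nat_ext g i = nat_ext g' i by have := E i.+1 im; rewrite !hurwitz1.
have gi1 : nat_ext g i.+1 = nat_ext g' i.+1.
  by have := E i (ltnW im); rewrite !hurwitz0 gi => /conjg_inj.
apply/ffunP => j; have [ji|ji] := eqVneq (val j) i.
  by move: gi; rewrite /nat_ext -ji inord_val.
have [ji1|ji1] := eqVneq (val j) i.+1.
  by move: gi1; rewrite /nat_ext -ji1 inord_val.
have := E j; rewrite -ltnS ltn_ord => /(_ isT).
by rewrite /hurwitz (negPf ji) (negPf ji1) /nat_ext inord_val.
Qed.

(** Passing to [ntens] and [nrho] multiplies the scalar of [braid_op_tvec] by roots of exactly the
    [mutower] and [kappa] values in its power, so the result is torsion. *)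
Lemma monomial_braid_op i : monomial (braid_op omega V m i) (swap i) (hurwitz_conj i).
Proof.
move=> g; have im : (i < m)%N by exact: ltn_ord.
have [c0 c0X E] := braid_op_tvec (nat_ext g) im.
pose g' := twist (swap i) (hurwitz_conj i) g.
have mg' : mutower m (hurwitz i (nat_ext g)) = mutower m (nat_ext g').
  by apply: eq_mutower => j jm; rewrite nat_ext_twist_swap.
set r := rt (kappa (nat_ext g i) (nat_ext g i.+1)).
have r0 : r != 0 by rewrite rt_neq0 ?kappa_neq0.
exists (c0 * rt (mutower m (nat_ext g)) / (r * rt (mutower m (nat_ext g')))).
  rewrite /torsion !exprMn exprVn exprMn !rtX c0X mg'.
  by field; rewrite !mutower_neq0 kappa_neq0.
move=> v hv; have hev j : homog (nat_ext g j) (nat_ext v j) by apply: hv.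
rewrite -/g' linearZ /= E // /ntens.
rewrite (@tvec_scale m (fun j => if j == i :> nat then r^-1 else 1) _
  (nat_ext (fun j => nrho (hurwitz_conj i g j) (v (swap i j))))) => [|j jm].
  rewrite (bigD1 (strand i)) //= eqxx big1 ?mulr1 => [|j]; last first.
    by rewrite -val_eqE /= => /negPf ->.
  rewrite !scalerA; congr (_ *: _).
  by field; rewrite rt_neq0 ?mutower_neq0.
rewrite /hurwitzv /nat_ext /hurwitz_conj /= inordK //.
case: eqP => [->|/eqP ji].
  rewrite inord_strand tpermL -inord_next_strand -inord_strand.
  by rewrite (nrho_homogE _ (hev _)) scalerA mulVf ?scale1r.
rewrite scale1r (nrho1 (hv _)); case: eqP => [->|/eqP ji1].
  by rewrite inord_next_strand tpermR inord_strand.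
by rewrite swap_out /= ?inordK.
Qed.

Lemma monomial_letter_op l : exists h, [/\ respects h,
  injective (twist (swap l.1) h) & monomial (letter_op omega V l) (swap l.1) h].
Proof.
case: l => i [] /=; last first.
  exists (hurwitz_conj i); split; [exact: respects_hurwitz_conj | exact: twist_swap_inj |].
  exact: monomial_braid_op.
apply: (monomial_inv (monomial_braid_op i)).
- exact: respects_hurwitz_conj.
- exact: twist_swap_inj.
exact: tperm2.
Qed.

Lemma monomial_word_op w : exists2 h, respects h &
  monomial (word_op omega V w) (word_perm w) h.
Proof.
elim: w => [|l w [h rh mw]].
  exists (fun _ _ => 1%g); first exact: respects1.
  by rewrite /word_perm big_nil; apply: monomial1.
have [hl [rl _ ml]] := monomial_letter_op l.
exists (twist_comp (word_perm w) h (swap l.1) hl); first exact: respects_comp.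
by rewrite /word_perm big_cons; apply: monomial_comp.
Qed.

Lemma word_op_cat w w' :
  word_op omega V (w ++ w') = (word_op omega V w \o word_op omega V w')%VF.
Proof.
by elim: w => [|l w IH] /=; rewrite ?comp_lfun1l // IH comp_lfunA.
Qed.

End Words.
End Monomial.
End Module.
End Grading.

(** * Roots in an algebraically closed field *)

Lemma root_function (k : closedFieldType) (q : nat) : (0 < q)%N ->
  exists2 rt : k -> k, forall x, rt x ^+ q = x & rt 1 = 1.
Proof.
move=> q0.
have /choice[r rP] (x : k) : exists y, y ^+ q = x.
  have [y yE] := solve_monicpoly (fun i => if i == 0%N then x else 0) q0.
  exists y; rewrite yE; case: q q0 {yE} => // q _.
  rewrite big_ord_recl expr0 mulr1 big1 ?addr0 // => i _.
  by rewrite mul0r.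
(* The chosen root of 1 may be another root of unity, so its value is overridden. *)
exists (fun x => if x == 1 then 1 else r x) => [x|]; last by rewrite eqxx.
by case: eqP => [->|_]; rewrite ?expr1n.
Qed.

Lemma roots_of_unity_finite (k : closedFieldType) (q : nat) : (0 < q)%N ->
  exists roots : seq k, forall c, c ^+ q = 1 -> c \in roots.
Proof.
move=> q0; have [roots E] := closed_field_poly_normal ('X^q - 1 : {poly k}).
exists roots => c cq; rewrite -root_prod_XsubC.
have <- : root ('X^q - 1) c = root (\prod_(z <- roots) ('X - z%:P)) c.
  by rewrite E rootZ // lead_coef_eq0 -size_poly_eq0 size_XnsubC //.
by rewrite rootE !hornerE cq subrr.
Qed.

Theorem theorem4p5 (k : closedFieldType) (p : nat) (gT : finGroupType)
    (omega : gT -> gT -> gT -> k) (V : dspace k gT) (n : nat) :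
  prime p -> (p.-group [set: gT])%g -> normalized_cocycle omega ->
  is_module omega V -> (0 < n)%N ->
  finite_pgroup_of_endos p (@pure_braid_image k gT omega V n).
Proof.
move=> pr_p pG coc modV; case: n => // m _.
have G0 : (0 < #|gT|)%N by rewrite -cardsT cardG_gt0.
have [rt rtX rt1] := root_function k G0.
have [roots rootsP] := roots_of_unity_finite k G0.
have [L LP] := monomial_finite coc modV rtX m rootsP.
apply: (@finite_pgroup_of_lpow _ _ _ _ L) => //.
- move=> f [w _ ->]; have [h _ mh] := monomial_word_op coc modV rtX rt1 w.
  exact: LP mh.
- by exists [::]; rewrite // /pure_braid braid_permE /word_perm big_nil.
- move=> f f' [w pw ->] [w' pw' ->]; exists (w ++ w'); last by rewrite word_op_cat.
  by move: pw pw'; rewrite /pure_braid !braid_permE word_perm_cat => -> ->; rewrite mulg1.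
move=> f [w + ->]; rewrite /pure_braid braid_permE => pw.
have [h rh] := monomial_word_op coc modV rtX rt1 w; rewrite pw => mh.
have [e Te] := iter_twist_pgroup pr_p pG rh.
(* [p ^ e] iterations restore all degrees; the two factors [#|gT|] required by [monomial_order] are
   themselves powers of [p]. *)
have cG : #|gT| = (p ^ logn p #|gT|)%N by rewrite -cardsT; apply: card_pgroup.
exists (e + logn p #|gT| + logn p #|gT|)%N.
rewrite !expnD -cG; apply: (monomial_order coc modV rtX rt1 mh) => //.
exact: expg1n.
Qed.
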